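(* For every integer $n \geq 0$, \[ B_n \setminus \{0\} = \coprod_{j=0}^{\lfloor n/2\rfloor} 2^j S_{n-2j}, \] where the union is disjoint and $2^j S$ denotes $\{2^j s : s \in S\}$.
   Context: For $n \geq 0$, $B_n = \left\{ \sum_{j=0}^n v_j (1+i)^j : v_j \in \{0,\pm 1,\pm i\}\right\} \subset \mathbb{Z}[i]$. For $n\geq 0$ define $w_n = 2^{k+1}+2^k$ if $n=2k$ and $w_n = 2^{k+2}$ if $n=2k+1$. For $n\geq 0$ define \[ S_n = \{ x+yi \in \mathbb{Z}[i]\setminus\{0\} : 2 \nmid \gcd(x,y);\ |x|,|y| \leq w_n - 2;\ |x|+|y| \leq w_{n+1}-3 \}. \] *)

(* Defs.v *)
From mathcomp Require Import all_boot all_order all_algebra all_field.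
From mathcomp Require Import boolp classical_sets.

Set Implicit Arguments.
Unset Strict Implicit.
Unset Printing Implicit Defensive.

Import Order.TTheory GRing.Theory Num.Theory.
Local Open Scope classical_set_scope.
Local Open Scope ring_scope.

(* Gaussian integers are represented inside algC, as the numbers
   x%:~R + y%:~R * 'i with x, y : int. *)

Definition digits : set algC := [set v | v \in [:: 0; 1; -1; 'i; -'i]].

Definition B_ (n : nat) : set algC :=
  [set z | exists2 v : 'I_n.+1 -> algC,
     forall j, digits (v j) & z = \sum_(j < n.+1) v j * (1 + 'i) ^+ j].

Definition w_ (n : nat) : nat :=
  let k := n./2 in
  if odd n then (2 ^ (k + 2))%N else (2 ^ (k + 1) + 2 ^ k)%N.

(* The bounds are computed in int, so no subtraction is truncated. *)
Definition S_ (n : nat) : set algC :=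
  [set z | exists x y : int,
     [/\ z = x%:~R + y%:~R * 'i,
         z <> 0,
         ~~ (2 %| gcdz x y)%Z,
         `|x| <= (w_ n)%:Z - 2 /\ `|y| <= (w_ n)%:Z - 2
       & `|x| + `|y| <= (w_ n.+1)%:Z - 3]].

Definition dilate (a : algC) (A : set algC) : set algC :=
  [set a * s | s in A].

(* Main.v *)
Require Import Defs.
From mathcomp Require Import all_boot all_order all_algebra all_field.
From mathcomp Require Import boolp classical_sets.
From mathcomp Require Import zify ring.

Set Implicit Arguments.
Unset Strict Implicit.
Unset Printing Implicit Defensive.

Import Order.TTheory GRing.Theory Num.Theory.
Local Open Scope classical_set_scope.
Local Open Scope ring_scope.

(** The sets satisfy [B_(n+1) = digits + (1+i) B_n], so it suffices to show that the
    candidate [U_n], consisting of 0 and the [2^j S_(n-2j)], obeys the same recursion.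
    Multiplication by [1+i] maps [U_n] into [U_(n+1)], and adding a nonzero digit
    afterwards lands in [S_(n+1)], since the coordinate sum becomes odd and the bounds
    on [U_n] leave room for it.  Conversely a point [z] of [S_(n+1)] divisible by [1+i]
    has its quotient in [S_n], and otherwise some unit digit [d] brings [z - d] inside
    the bounds while keeping [(z - d)/(1+i)] not divisible by 2.  The pieces are disjoint
    because [2^j] is the exact power of 2 dividing the points of [2^j S_(n-2j)]. *)

(** * Recursion and parity of the bounds [w_n] *)

Lemma w_SS n : w_ n.+2 = (2 * w_ n)%N.
Proof.
rewrite /w_ /= negbK; case: (odd n); rewrite ?addSn !expnS; lia.
Qed.

Lemma w_ge3 n : (3 <= w_ n)%N.
Proof.
suff: (3 <= w_ n)%N /\ (3 <= w_ n.+1)%N by case.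
by elim: n => [|n [h1 h2]] //; split=> //; rewrite w_SS; lia.
Qed.

Lemma w_S_even n : exists c, w_ n.+1 = (2 * c)%N.
Proof.
case: n => [|n]; first by exists 2%N.
by exists (w_ n); rewrite w_SS.
Qed.

Lemma w_S_le n : (w_ n.+1 + 2 <= 2 * w_ n)%N.
Proof.
suff: (w_ n.+1 + 2 <= 2 * w_ n)%N /\ (w_ n.+2 + 2 <= 2 * w_ n.+1)%N by case.
by elim: n => [|n [h1 h2]] //; split=> //; rewrite (w_SS n.+1) (w_SS n); lia.
Qed.

(** * The candidate sets in integer coordinates *)

Definition primitive_octagon (n : nat) (x y : int) : Prop :=
  [/\ ~~ (2 %| x)%Z || ~~ (2 %| y)%Z,
      `|x| <= (w_ n)%:Z - 2, `|y| <= (w_ n)%:Z - 2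
    & `|x| + `|y| <= (w_ n.+1)%:Z - 3].

(** The set [U_n] in coordinates. One doubling rule replaces the union over [j], so that inclusions
    go by induction on derivations. *)
Inductive dyadic_octagons : nat -> int -> int -> Prop :=
| dyadic_zero n : dyadic_octagons n 0 0
| dyadic_primitive n x y : primitive_octagon n x y -> dyadic_octagons n x y
| dyadic_double n x y :
    dyadic_octagons n x y -> dyadic_octagons n.+2 (2 * x) (2 * y).

Lemma dyadic_octagons_bound n x y : dyadic_octagons n x y ->
  [/\ `|x| <= (w_ n)%:Z - 2, `|y| <= (w_ n)%:Z - 2
    & `|x| + `|y| <= (w_ n.+1)%:Z - 3].
Proof.
elim=> {n x y} [n|n x y []|n x y _ [hx hy hxy]] //.
- by move: (w_ge3 n) (w_ge3 n.+1); split; lia.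
- by move: (w_SS n) (w_SS n.+1); split; lia.
Qed.

(** Conjugation and the swap of coordinates generate the eight symmetries of the square, which later
    allow a reduction to the sector [0 <= y <= x]. *)
Lemma dyadic_octagons_neg n x y :
  dyadic_octagons n x y -> dyadic_octagons n x (- y).
Proof.
elim=> {n x y} [n|n x y [hp hx hy hxy]|n x y _ IH].
- by rewrite oppr0; apply: dyadic_zero.
- by apply: dyadic_primitive; split; lia.
- by rewrite -mulrN; apply: dyadic_double.
Qed.

Lemma dyadic_octagons_swap n x y :
  dyadic_octagons n x y -> dyadic_octagons n y x.
Proof.
elim=> {n x y} [n|n x y [hp hx hy hxy]|n x y _ IH].
- exact: dyadic_zero.
- by apply: dyadic_primitive; split; lia.
- exact: dyadic_double.
Qed.

Lemma dyadic_octagons_mul1i n x y :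
  dyadic_octagons n x y -> dyadic_octagons n.+1 (x - y) (x + y).
Proof.
elim=> {n x y} [n|n x y [hp hx hy hxy]|n x y _ IH].
- exact: dyadic_zero.
- have [hev|hodd] := boolP (2 %| x - y)%Z; last first.
    by apply: dyadic_primitive; move: (w_SS n); split; lia.
  case: n hx hy hxy => [|n] hx hy hxy.
    by exfalso; rewrite /w_ /= in hxy; lia.
  have -> : x - y = 2 * ((x - y) %/ 2)%Z by lia.
  have -> : x + y = 2 * ((x + y) %/ 2)%Z by lia.
  apply/dyadic_double/dyadic_primitive.
  (* Both [x] and [y] are odd and [w_ n.+1] is even, so [|x|, |y| <= w_ n.+1 - 3]. The larger of
     [|x|, |y|] is the sum of the absolute coordinates of the half. *)
  have [c hc] := w_S_even n.
  by move: (w_SS n); split; lia.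
- by rewrite -mulrBr -mulrDr; apply: dyadic_double.
Qed.

Lemma dyadic_octagons_add_digit n x y dx dy : `|dx| + `|dy| <= 1 ->
  dyadic_octagons n x y -> dyadic_octagons n.+1 (dx + (x - y)) (dy + (x + y)).
Proof.
move=> hd hU.
have [h0|h1] := eqVneq (`|dx| + `|dy|) 0.
  have [-> ->] : dx = 0 /\ dy = 0 by lia.
  by rewrite !add0r; apply: dyadic_octagons_mul1i.
have [[hx hy hxy] hw] := (dyadic_octagons_bound hU, w_SS n).
by apply: dyadic_primitive; split; lia.
Qed.

(** * Removing a digit and dividing by [1+i] *)

Definition digit_step (P : int -> int -> Prop) (x y : int) : Prop :=
  exists dx dy x' y', [/\ `|dx| + `|dy| <= 1,
    x = dx + (x' - y'), y = dy + (x' + y') & P x' y'].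

Lemma digit_step_neg n x y : digit_step (dyadic_octagons n) x y ->
  digit_step (dyadic_octagons n) (- x) y.
Proof.
move=> [dx [dy [x' [y' [hd -> -> hU]]]]].
(* Conjugation turns [1+i] into [1-i = -i(1+i)], so the quotient becomes [i] times its conjugate,
   which swaps its coordinates. *)
exists (- dx), dy, y', x'; split; [lia|lia|lia|exact: dyadic_octagons_swap].
Qed.

Lemma digit_step_swap n x y : digit_step (dyadic_octagons n) x y ->
  digit_step (dyadic_octagons n) y x.
Proof.
move=> [dx [dy [x' [y' [hd -> -> hU]]]]].
exists dy, dx, x', (- y'); split; [lia|lia|lia|exact: dyadic_octagons_neg].
Qed.

Lemma primitive_octagon_digit_step_sector n x y : 0 <= y <= x ->
  primitive_octagon n.+1 x y -> digit_step (dyadic_octagons n) x y.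
Proof.
move=> hyx [hp hx hy hxy].
have [c hc] := w_S_even n; have hS := w_SS n; have hle := w_S_le n.
(* When [1+i] divides [z - d], the quotient is [s + ti]. Then [|s| + |t|] is the larger of
   [|x - dx|, |y - dy|], and the larger of [|s|, |t|] is half their sum, whence the bounds required
   below. *)
pose s dx dy := ((x - dx + (y - dy)) %/ 2)%Z.
pose t dx dy := ((y - dy - (x - dx)) %/ 2)%Z.
suff [dx [dy [hd hev [hodd hm hsum]]]] : exists dx dy : int,
    [/\ `|dx| + `|dy| <= 1, (2 %| x - dx + (y - dy))%Z &
      [/\ ~~ (4 %| x - dx + (y - dy))%Z || ~~ (4 %| y - dy - (x - dx))%Z,
          `|x - dx| <= (w_ n.+1)%:Z - 3 /\ `|y - dy| <= (w_ n.+1)%:Z - 3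
        & `|x - dx| + `|y - dy| <= 2 * (w_ n)%:Z - 4]].
  exists dx, dy, (s dx dy), (t dx dy).
  split=> //; rewrite /s /t; [lia|lia|].
  by apply: dyadic_primitive; case: hm => hm1 hm2; split; lia.
have [hev|hodd] := boolP (2 %| x + y)%Z.
  (* Both coordinates are odd, so parity sharpens each bound by one. *)
  by exists 0, 0; split; [lia|lia|split; lia].
(* Digit 1 moves towards the origin; it fails only if [2(1+i)] divides [z - 1],
   and then [(z -+ i)/(1+i)] is a unit modulo 2. *)
have [h4|h4] := boolP ((2 %| y)%Z && (4 %| x - 1 + y)%Z); last first.
  by exists 1, 0; split; [lia|lia|split; lia].
have [y0|y0] := eqVneq y 0.
  (* Here [|y - dy|] grows to 1. As [x] is odd, [x + 1 <= w_ n.+1 - 2], which is at most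
     [2 * w_ n - 4] by [w_S_le]. *)
  by exists 0, (-1); split; [lia|lia|split; lia].
by exists 0, 1; split; [lia|lia|split; lia].
Qed.

Lemma primitive_octagon_digit_step n x y :
  primitive_octagon n.+1 x y -> digit_step (dyadic_octagons n) x y.
Proof.
wlog hx0 : x y / 0 <= x.
  move=> IH hO; have [hx|hx] := leP 0 x; first exact: IH.
  rewrite -[x]opprK; apply: digit_step_neg; apply: IH; first lia.
  by case: hO => *; split; lia.
wlog hy0 : x y hx0 / 0 <= y.
  move=> IH hO; have [hy|hy] := leP 0 y; first exact: IH.
  apply: digit_step_swap; rewrite -[y]opprK; apply: digit_step_neg.
  apply: digit_step_swap; apply: IH; [lia|lia|].
  by case: hO => *; split; lia.
move=> hO; have [hyx|hxy] := leP y x.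
  by apply: primitive_octagon_digit_step_sector => //; lia.
apply: digit_step_swap; apply: primitive_octagon_digit_step_sector; first lia.
by case: hO => *; split; lia.
Qed.

(* A point 2u is (1+i) times (1-i)u, and up to a unit (1-i)u is (1+i)u. *)
Lemma dyadic_octagons_digit_step n x y :
  dyadic_octagons n.+1 x y -> digit_step (dyadic_octagons n) x y.
Proof.
move En: n.+1 => m hU; case: hU En => {m x y} [m|m x y hO|m x y hU] En.
- by exists 0, 0, 0, 0; split=> //; apply: dyadic_zero.
- by apply: primitive_octagon_digit_step; rewrite En.
- have -> : n = m.+1 by lia.
  exists 0, 0, (x + y), (y - x); split; [lia|lia|lia|].
  rewrite -opprB; apply: dyadic_octagons_neg; apply: dyadic_octagons_swap.
  exact: dyadic_octagons_mul1i.
Qed.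

Lemma dyadic_octagons0 x y : dyadic_octagons 0 x y <-> `|x| + `|y| <= 1.
Proof.
split=> [/dyadic_octagons_bound [_ _]|h]; first by rewrite /w_ /=; lia.
have [h0|h0] := eqVneq (`|x| + `|y|) 0.
  have [-> ->] : x = 0 /\ y = 0 by lia.
  exact: dyadic_zero.
by apply: dyadic_primitive; rewrite /primitive_octagon /w_ /=; split; lia.
Qed.

Lemma dyadic_octagons_pow2 j n x y : dyadic_octagons n x y ->
  dyadic_octagons (n + 2 * j) (2 ^+ j * x) (2 ^+ j * y).
Proof.
move=> hU; elim: j => [|j IH]; first by rewrite muln0 addn0 !expr0 !mul1r.
have -> : (n + 2 * j.+1 = (n + 2 * j).+2)%N by lia.
by rewrite !exprS -!mulrA; apply: dyadic_double.
Qed.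

Lemma dyadic_octagonsP n x y : dyadic_octagons n x y ->
  (x = 0 /\ y = 0) \/ exists j x' y', [/\ (j <= n./2)%N,
    x = 2 ^+ j * x', y = 2 ^+ j * y' & primitive_octagon (n - 2 * j) x' y'].
Proof.
elim=> {n x y} [n|n x y hO|n x y _ [[-> ->]|[j [x' [y' [hj -> -> hO]]]]]].
- by left.
- by right; exists 0%N, x, y; rewrite !expr0 !mul1r muln0 subn0.
- by left; rewrite !mulr0.
- right; exists j.+1, x', y'; rewrite !exprS -!mulrA; split=> //.
  by have -> : (n.+2 - 2 * j.+1 = n - 2 * j)%N by lia.
Qed.

(** * Gaussian integers and digits as algebraic numbers *)

Definition gauss (x y : int) : algC := x%:~R + y%:~R * 'i.

Lemma gauss_inj x y x' y' : gauss x y = gauss x' y' -> x = x' /\ y = y'.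
Proof.
move=> h.
have re a b : 'Re (gauss a b) = a%:~R.
  by rewrite /gauss mulrC Re_rect // realz.
have im a b : 'Im (gauss a b) = b%:~R.
  by rewrite /gauss mulrC Im_rect // realz.
by split; apply: (@intr_inj algC); rewrite -?(re x y) -?(im x y) h ?re ?im.
Qed.

Lemma gauss_scale c x y : gauss (c * x) (c * y) = c%:~R * gauss x y.
Proof. by rewrite /gauss !intrM; ring. Qed.

Lemma gauss_eq0 x y : gauss x y = 0 <-> x = 0 /\ y = 0.
Proof.
have e0 : gauss 0 0 = 0 by rewrite /gauss mul0r addr0.
by split=> [|[-> ->]//]; rewrite -e0; apply: gauss_inj.
Qed.

Lemma gauss_digit_step dx dy x y :
  gauss (dx + (x - y)) (dy + (x + y)) = gauss dx dy + (1 + 'i) * gauss x y.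
Proof.
have i2 := @sqrCi algC.
by rewrite /gauss !(intrD, intrB); ring: i2.
Qed.

Lemma digitsP d : digits d <->
  exists dx dy, `|dx| + `|dy| <= 1 /\ d = gauss dx dy.
Proof.
have e0 : gauss 0 0 = 0 by rewrite /gauss mul0r addr0.
have e1 : gauss 1 0 = 1 by rewrite /gauss mul0r addr0.
have eN1 : gauss (-1) 0 = -1 by rewrite /gauss mul0r addr0 rmorphN1.
have ei : gauss 0 1 = 'i by rewrite /gauss mul1r add0r.
have eNi : gauss 0 (-1) = - 'i by rewrite /gauss rmorphN1 mulN1r add0r.
rewrite /digits /= !inE; split=> [|[dx [dy [h ->]]]].
  case/or4P=> [/eqP->|/eqP->|/eqP->|/orP[] /eqP->].
  - by exists 0, 0.
  - by exists 1, 0.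
  - by exists (-1), 0.
  - by exists 0, 1.
  - by exists 0, (-1).
have : (dx = 0 /\ dy = 0) \/ (dx = 1 /\ dy = 0) \/ (dx = -1 /\ dy = 0) \/
  (dx = 0 /\ dy = 1) \/ (dx = 0 /\ dy = -1) by lia.
by move=> [|[|[|[|]]]] [-> ->]; rewrite ?e0 ?e1 ?eN1 ?ei ?eNi eqxx ?orbT.
Qed.

(** * Digit expansions and the sets [S_n] in coordinates *)

Lemma B_0 : B_ 0 = digits.
Proof.
apply/seteqP; split=> z.
  by move=> [v hv ->]; rewrite big_ord1 expr0 mulr1.
by move=> hz; exists (fun=> z) => //; rewrite big_ord1 expr0 mulr1.
Qed.

(** Horner's scheme: the lowest digit splits off, and the remaining sum has a factor [1 + 'i]. *)
Lemma B_S n z : B_ n.+1 z <->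
  exists d u, [/\ digits d, B_ n u & z = d + (1 + 'i) * u].
Proof.
split=> [[v hv ->]|[d [u [hd [v hv ->] ->]]]].
  exists (v ord0), (\sum_(j < n.+1) v (lift ord0 j) * (1 + 'i) ^+ j).
  split=> //; first by exists (fun j => v (lift ord0 j)).
  rewrite big_ord_recl expr0 mulr1 mulr_sumr; congr (_ + _).
  by apply: eq_bigr => j _; rewrite lift0 exprS mulrCA.
(* [unlift] is empty exactly at index 0, so the default value [d] becomes the lowest digit. *)
exists (fun j => oapp v d (unlift ord0 j)).
  by move=> j; case: unliftP => [k|] _ /=.
rewrite [RHS]big_ord_recl unlift_none expr0 mulr1 mulr_sumr; congr (_ + _).
by apply: eq_bigr => j _; rewrite liftK lift0 exprS mulrCA.
Qed.

Lemma B_P n z : B_ n z <->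
  exists x y, dyadic_octagons n x y /\ z = gauss x y.
Proof.
elim: n z => [|n IH] z.
  rewrite B_0; split=> [/digitsP|] [x [y [h ->]]].
    by exists x, y; split=> //; apply/dyadic_octagons0.
  by apply/digitsP; exists x, y; split=> //; apply/dyadic_octagons0.
split=> [/B_S [_ [_ [/digitsP[dx [dy [hd ->]]] /IH[x [y [hU ->]]] ->]]]|].
  exists (dx + (x - y)), (dy + (x + y)); rewrite gauss_digit_step; split=> //.
  exact: dyadic_octagons_add_digit.
move=> [_ [_ [/dyadic_octagons_digit_step
  [dx [dy [x [y [hd -> -> hU]]]]] ->]]].
apply/B_S; exists (gauss dx dy), (gauss x y); rewrite gauss_digit_step.
by split=> //; [apply/digitsP; exists dx, dy|apply/IH; exists x, y].
Qed.

Lemma S_P n z : S_ n z <->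
  exists x y, primitive_octagon n x y /\ z = gauss x y.
Proof.
split=> [[x [y [-> _ hg [hx hy] hxy]]]|[x [y [[hp hx hy hxy] ->]]]];
  exists x, y.
  by split=> //; split=> //; rewrite -negb_and -dvdz_gcd.
split=> //; last by rewrite dvdz_gcd negb_and.
by move/gauss_eq0 => [x0 y0]; rewrite x0 y0 in hp.
Qed.

(** * Disjointness and the decomposition *)

Lemma pow2_primitive_octagon_inj i j m n x y x' y' :
  primitive_octagon m x y -> primitive_octagon n x' y' ->
  2 ^+ i * x = 2 ^+ j * x' -> 2 ^+ i * y = 2 ^+ j * y' -> i = j.
Proof.
wlog lt_ij : i j m n x y x' y' / (i < j)%N.
  move=> IH h h' ex ey; case: (ltngtP i j) => // hij.
    exact: (IH i j m n x y x' y').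
  by apply/esym; apply: (IH j i n m x' y' x y).
move=> [hp _ _ _] _.
(* Cancelling [2 ^+ i] when [i < j] leaves [x] and [y] both even, against primitivity. *)
rewrite -(subnKC lt_ij) addSnnS exprD exprS -!mulrA => /mulfI ex /mulfI ey.
have ni : (2 : int) ^+ i != 0 by rewrite expf_neq0.
by move: hp; rewrite (ex ni) (ey ni) !dvdz_mulr.
Qed.

Theorem theorem2p2 (n : nat) :
  B_ n `\ 0 =
    \bigcup_(j in [set j | (j <= n./2)%N]) dilate (2 ^+ j) (S_ (n - 2 * j))
  /\ trivIset [set j | (j <= n./2)%N] (fun j => dilate (2 ^+ j) (S_ (n - 2 * j))).
Proof.
have pow2 j x y : gauss (2 ^+ j * x) (2 ^+ j * y) = 2 ^+ j * gauss x y.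
  by rewrite gauss_scale rmorphXn.
split.
- apply/seteqP; split=> z.
    move=> [/B_P[x [y [hU ->]]] nz].
    case: (dyadic_octagonsP hU) => [/gauss_eq0//|].
    move=> [j [x' [y' [hj -> -> hO]]]]; exists j => //.
    by exists (gauss x' y'); rewrite ?pow2 //; apply/S_P; exists x', y'.
  move=> [j /= hj [_ /S_P[x [y [hO ->]]] <-]]; split.
    apply/B_P; exists (2 ^+ j * x), (2 ^+ j * y); split=> //.
    have {1}-> : n = (n - 2 * j + 2 * j)%N by lia.
    exact/dyadic_octagons_pow2/dyadic_primitive.
  move=> /= /eqP; rewrite mulf_eq0 expf_eq0 pnatr_eq0 andbF /= => /eqP.
  by move=> /gauss_eq0 [x0 y0]; case: hO; rewrite x0 y0.
- move=> i j _ _ [_ [[_ /S_P[x [y [hO ->]]] <-] [_ /S_P[x' [y' [hO' ->]]]]]].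
  rewrite -!pow2 => /gauss_inj [ex ey]; apply/esym.
  exact: pow2_primitive_octagon_inj hO' hO ex ey.
Qed.
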